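(* The category $\mathbf{CompHaus}^{\mathrm{op}}$, the opposite of the category of compact Hausdorff spaces and continuous maps, is not finitely concrete.
   Context: A category $\mathcal K$ is called finitely concrete if there is a faithful functor $U\colon\mathcal K\to\mathbf{Set}$ that preserves every directed colimit that exists in $\mathcal K$, where $\mathbf{Set}$ is the category of sets and functions. *)

(* Defs.v *)
From mathcomp Require Import all_boot.
From mathcomp Require Import boolp classical_sets topology.

Set Implicit Arguments.
Unset Strict Implicit.
Unset Printing Implicit Defensive.

Local Open Scope classical_set_scope.

(* The universe of small sets. It is the universe of the carriers of
   topological spaces, so that CompHaus, Sets and the index posets of directed
   diagrams all refer to the same notion of smallness. *)
Notation smallType := Type@{Topological.axioms_.u0}.

Record category := Category {
  obj :> Type;
  hom : obj -> obj -> Type;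
  idm : forall a, hom a a;
  cmp : forall a b c, hom b c -> hom a b -> hom a c;
  cmpA : forall a b c d (h : hom c d) (g : hom b c) (f : hom a b),
    cmp h (cmp g f) = cmp (cmp h g) f;
  cmp1m : forall a b (f : hom a b), cmp (idm b) f = f;
  cmpm1 : forall a b (f : hom a b), cmp f (idm a) = f }.

Arguments idm {c0} a : rename.
Arguments cmp {c0 a b c} g f : rename.

Definition opposite (K : category) : category.
Proof.
refine (@Category K (fun a b => hom b a) (fun a => idm a)
  (fun a b c g f => cmp f g) _ _ _).
- by move=> a b c d h g f; rewrite cmpA.
- by move=> a b f; rewrite cmpm1.
- by move=> a b f; rewrite cmp1m.
Defined.

Record functor (K L : category) := Functor {
  fobj :> K -> L;
  fmap : forall a b : K, hom a b -> hom (fobj a) (fobj b);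
  fmap_id : forall a : K, fmap (idm a) = idm (fobj a);
  fmap_cmp : forall (a b c : K) (g : hom b c) (f : hom a b),
    fmap (cmp g f) = cmp (fmap g) (fmap f) }.

Definition faithful (K L : category) (U : functor K L) : Prop :=
  forall (a b : K) (f g : hom a b), fmap U f = fmap U g -> f = g.

Definition fcomp (K L M : category) (G : functor L M) (F : functor K L) :
  functor K M.
Proof.
refine (@Functor K M (fun a => G (F a)) (fun a b f => fmap G (fmap F f)) _ _).
- by move=> a; rewrite !fmap_id.
- by move=> a b c g f; rewrite !fmap_cmp.
Defined.

Record cocone (J K : category) (D : functor J K) := Cocone {
  apex : K;
  leg : forall j : J, hom (D j) apex;
  leg_natural : forall (i j : J) (f : hom i j), cmp (leg j) (fmap D f) = leg i }.

Definition is_colimit (J K : category) (D : functor J K) (c : cocone D) : Prop :=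
  forall c' : cocone D, exists! h : hom (apex c) (apex c'),
    forall j : J, cmp h (leg c j) = leg c' j.

Definition map_cocone (J K L : category) (U : functor K L) (D : functor J K)
  (c : cocone D) : cocone (fcomp U D).
Proof.
refine (@Cocone J L (fcomp U D) (U (apex c)) (fun j => fmap U (leg c j)) _).
by move=> i j f /=; rewrite -fmap_cmp leg_natural.
Defined.

Record directedPoset := DirectedPoset {
  elt :> smallType;
  below : elt -> elt -> Prop;
  below_refl : forall i, below i i;
  below_trans : forall i j k, below i j -> below j k -> below i k;
  below_antisym : forall i j, below i j -> below j i -> i = j;
  directed_nonempty : exists i : elt, True;
  directed_ub : forall i j, exists k, below i k /\ below j k }.

(* The proofs of [below i j] are the only morphisms from i to j: they are all
   equal by proof irrelevance. *)
Definition poset_category (J : directedPoset) : category.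
Proof.
refine (@Category J (fun i j => below i j) (@below_refl J)
  (fun i j k g f => below_trans f g) _ _ _);
  by move=> *; exact: Prop_irrelevance.
Defined.

Definition preserves_directed_colimits (K L : category) (U : functor K L) :
    Prop :=
  forall (J : directedPoset) (D : functor (poset_category J) K) (c : cocone D),
    is_colimit c -> is_colimit (map_cocone U c).

Definition Sets : category :=
  @Category smallType (fun A B => A -> B) (fun A => idfun)
    (fun A B C g f => g \o f)
    (fun A B C D h g f => erefl) (fun A B f => erefl) (fun A B f => erefl).

Definition finitely_concrete (K : category) : Prop :=
  exists U : functor K Sets, faithful U /\ preserves_directed_colimits U.

(* A [topologicalType] may be empty. It carries a choice operator, which
   classically exists on every type and which continuous maps ignore. *)
Record compHausSpace := CompHausSpace {
  space :> topologicalType;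
  space_compact : compact [set: space];
  space_hausdorff : hausdorff_space space }.

Definition CompHaus : category.
Proof.
refine (@Category compHausSpace (fun X Y => continuousType X Y)
  (fun X => idfun) (fun X Y Z g f => g \o f) _ _ _);
  by move=> *; apply/continuousEP.
Defined.

(* Main.v *)
From mathcomp Require Import all_boot all_order all_algebra.
From mathcomp Require Import boolp classical_sets functions reals.
From mathcomp Require Import topology normedtype Rstruct.
Require Import Defs.

(** A functor from the opposite of CompHaus to Sets is a contravariant functor
    U on compact Hausdorff spaces; write f^* : U Y -> U X for its value at
    f : X -> Y. Preserving directed colimits means turning directed inverse
    limits of spaces into directed colimits of sets.

    A point a of X is the intersection, hence the inverse limit, of its closed
    neighbourhoods ([closed_cocone_colimit], [bigcap_closed_nbhs]). Two elements
    of a directed colimit of sets agree only if they already agree at some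
    stage ([colimit_leg_eq]), so elements of U X which agree at the point a
    agree on a closed neighbourhood of a ([pull_agree_nbhs]): elements of U X
    have germs, as sections of a sheaf do.

    Any x in U X agrees at a with the constant element (const_a)^* x, where
    const_a : X -> X takes the value a everywhere. They therefore agree on a
    closed neighbourhood B of a, and for b in B, pulling back further along the
    map X -> B with constant value b gives (const_b)^* x = (const_a)^* x. Thus
    the function a |-> (const_a)^* x is locally constant, and so constant when X
    is connected ([pull_constant]). On the unit interval this means that
    const_0 and const_1 have the same image under U, although they differ: U is
    not faithful. *)

Set Implicit Arguments.
Unset Strict Implicit.
Unset Printing Implicit Defensive.

Import Order.TTheory GRing.Theory Num.Theory.

Local Open Scope classical_set_scope.

(** * Directed colimits of sets *)

Definition transition (J : directedPoset) (D : functor (poset_category J) Sets)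
    (i j : J) (ij : below i j) : D i -> D j :=
  fmap D (ij : @hom (poset_category J) i j).

Lemma transition_trans (J : directedPoset)
    (D : functor (poset_category J) Sets) (i j k : J)
    (ij : below i j) (jk : below j k) (ik : below i k) (z : D i) :
  transition jk (transition ij z) = transition ik z.
Proof.
rewrite (Prop_irrelevance ik (below_trans ij jk)).
exact: (congr1 (fun g => g z) (esym (fmap_cmp D
  (jk : @hom (poset_category J) j k) (ij : @hom (poset_category J) i j)))).
Qed.

(** Say that two elements of two stages meet if they become equal at some later
    stage. Mapping an element of any stage to the set of those w in the stage i
    which it meets defines a cocone. It factors through the colimit, so it takes
    equal values at x and y; as y meets itself, x meets y. *)
Lemma colimit_leg_eq (J : directedPoset) (D : functor (poset_category J) Sets)
    (c : cocone D) (colc : is_colimit c) (i : J) (x y : D i) :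
  leg c i x = leg c i y ->
  exists (k : J) (ik : below i k), transition ik x = transition ik y.
Proof.
move=> xy.
pose T (j : J) (z : D j) : set (D i) := [set w |
  exists (k : J) (ik : below i k) (jk : below j k),
    transition jk z = transition ik w].
have Tnat (j l : J) (f : @hom (poset_category J) j l) :
    @cmp Sets (D j) (D l) (set (D i)) (T l) (fmap D f) = T j.
  apply/funext => z; apply/seteqP; split => w /= [k [ik [jk e]]].
    exists k, ik, (below_trans f jk); rewrite -e.
    by rewrite -(transition_trans f jk).
  have [m [km lm]] := directed_ub k l.
  exists m, (below_trans ik km), lm.
  rewrite (transition_trans f lm (below_trans jk km)).
  rewrite -(transition_trans jk km (below_trans jk km)) e.
  exact: transition_trans.
have [h [hT _]] := colc (@Cocone (poset_category J) Sets D (set (D i)) T Tnat).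
have hE z : h (leg c i z) = T i z := congr1 (fun g => g z) (hT i).
have : T i x y.
  by rewrite -hE xy hE /T /=; exists i, (below_refl i), (below_refl i).
move=> [k [ik [ik' e]]]; exists k, ik.
by rewrite {1}(Prop_irrelevance ik ik').
Qed.

(** * Subspaces *)

Lemma connected_locally_constant (X : topologicalType) (T : Type) (c : X -> T) :
  connected [set: X] -> (forall a, \forall b \near a, c b = c a) ->
  forall a b, c a = c b.
Proof.
move=> conX lc a b.
have oc (P : set T) : open (c @^-1` P).
  rewrite openE => x Px; rewrite /interior.
  by apply: filterS (lc x) => y /= ->.
have E : [set x | c x = c a] = [set: X].
  apply: conX; first by exists a.
    exists [set x | c x = c a]; first exact: (oc [set t | t = c a]).
    by rewrite setTI.
  exists [set x | c x = c a]; last by rewrite setTI.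
  rewrite -[X in closed X]setCK; apply: open_closedC.
  exact: (oc [set t | t <> c a]).
by have /esym : [set x | c x = c a] b by rewrite E.
Qed.

(** Exhibits a nonempty subspace as the image of the subset under a map
    continuous on it (the value y outside A is a mere filler), so that
    properties of the subset that pass to continuous images pass to the
    subspace. *)
Lemma set_type_image (X : topologicalType) (A : set X) (y : A) :
  {within A, continuous (valL_ y (idfun : A -> A))} /\
  valL_ y (idfun : A -> A) @` A = [set: A].
Proof.
split; first by apply/subspace_valL_continuousP' => x.
apply/seteqP; split => // x _.
exists (set_val x); first exact: set_valP.
by rewrite [LHS](congr1 (fun g => g x) (valLK y (idfun : A -> A))).
Qed.

Lemma set_type_compact (X : topologicalType) (A : set X) :
  compact A -> compact [set: A].
Proof.
move=> cA; have [[y _]|A0] := pselect (exists y : A, True); last first.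
  suff -> : [set: A] = set0 by exact: compact0.
  by apply/seteqP; split => // x _; apply: A0; exists x.
have [cont <-] := set_type_image y.
exact: continuous_compact.
Qed.

Lemma set_type_connected (X : topologicalType) (A : set X) :
  connected A -> connected [set: A].
Proof.
move=> cA; have [[y _]|A0] := pselect (exists y : A, True); last first.
  suff -> : [set: A] = set0 by exact: connected0.
  by apply/seteqP; split => // x _; apply: A0; exists x.
have [cont <-] := set_type_image y.
exact: connected_continuous_connected.
Qed.

Lemma set_val_continuous (X : topologicalType) (A : set X) :
  continuous (set_val : A -> X).
Proof. exact: (@initial_continuous A X set_val). Qed.

Lemma set_type_hausdorff (X : topologicalType) (A : set X) :
  hausdorff_space X -> hausdorff_space A.
Proof.
move=> hX p q pq; apply: val_inj; apply: hX => U V pU qV.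
have [x [Ux Vx]] := pq _ _ (set_val_continuous pU) (set_val_continuous qV).
by exists (set_val x).
Qed.

Definition compactSub (X : topologicalType) (A : set X)
    (hX : hausdorff_space X) (cA : compact A) : compHausSpace :=
  CompHausSpace (set_type_compact cA) (@set_type_hausdorff X A hX).

Definition corestrict_fun (X Y : topologicalType) (A : set X)
  (f : Y -> X) (fA : forall y, A (f y)) (y : Y) : A := SigSub (mem_set (fA y)).

Lemma corestrict_continuous (X Y : topologicalType) (A : set X)
    (f : Y -> X) (fA : forall y, A (f y)) :
  continuous f -> continuous (corestrict_fun fA).
Proof.
move=> /continuousP cf; apply/continuousP => _ [U oU <-].
exact: (cf U oU).
Qed.

Definition cmap (X Y : topologicalType) (f : X -> Y) (cf : continuous f) :
    continuousType X Y :=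
  @Continuous.Pack X Y f (Continuous.Class (isContinuous.Axioms_ Y f cf)).

(** * Intersections of closed subspaces as inverse limits *)

Section ClosedSubspaces.
Variable X : compHausSpace.
Implicit Types (B C : set X).

Lemma closed_compact_in B : closed B -> compact B.
Proof. by move=> clB; exact: (subclosed_compact clB (@space_compact X)). Qed.

Definition closedSub B (clB : closed B) : compHausSpace :=
  compactSub (@space_hausdorff X) (closed_compact_in clB).

Definition inclusion B (clB : closed B) : @hom CompHaus (closedSub clB) X :=
  cmap (@set_val_continuous X B).

Definition corestrict B (clB : closed B) (Y : compHausSpace)
    (f : @hom CompHaus Y X) (fB : forall y, B (f y)) :
    @hom CompHaus Y (closedSub clB) :=
  cmap (@corestrict_continuous X Y B f fB (@cts_fun _ _ f)).

Lemma inclusion_corestrict B (clB : closed B) (Y : compHausSpace)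
    (f : @hom CompHaus Y X) (fB : forall y, B (f y)) :
  @cmp CompHaus _ _ _ (inclusion clB) (corestrict clB fB) = f.
Proof. exact/continuousEP. Qed.

Lemma inclusion_inj B (clB : closed B) (Y : compHausSpace)
    (f g : @hom CompHaus Y (closedSub clB)) :
  @cmp CompHaus _ _ _ (inclusion clB) f =
    @cmp CompHaus _ _ _ (inclusion clB) g ->
  f = g.
Proof.
move=> fg; apply/continuousEP => y; apply: val_inj.
exact: (congr1 (fun h : continuousType Y X => h y) fg).
Qed.

Definition subset_incl B C (clB : closed B) (clC : closed C) (BC : B `<=` C) :
    @hom CompHaus (closedSub clB) (closedSub clC) :=
  @corestrict C clC (closedSub clB) (inclusion clB) (fun y => BC _ (set_valP y)).

End ClosedSubspaces.

Section ClosedIntersection.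
Variables (X : compHausSpace) (J : directedPoset) (A : J -> set X).
Hypothesis clA : forall i, closed (A i).
Hypothesis antiA : forall i j, below i j -> A j `<=` A i.

Definition closed_diagram : functor (poset_category J) (opposite CompHaus).
Proof.
refine (@Functor (poset_category J) (opposite CompHaus)
  (fun i => closedSub (@clA i) : opposite CompHaus)
  (fun i j ij => subset_incl (@clA j) (@clA i) (@antiA i j ij)) _ _).
- by move=> i; apply/continuousEP => y; apply: val_inj.
- by move=> i j k g f; apply/continuousEP => y; apply: val_inj.
Defined.

Variable (B : set X) (clB : closed B).
Hypothesis BA : B = \bigcap_i A i.

Let BsubA i : B `<=` A i. Proof. by rewrite BA => x; apply. Qed.

Definition closed_cocone : cocone closed_diagram.
Proof.
refine (@Cocone _ _ closed_diagram (closedSub clB : opposite CompHaus)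
  (fun i => subset_incl clB (@clA i) (@BsubA i)) _).
by move=> i j ij; apply/continuousEP => y; apply: val_inj.
Defined.

(** A compatible family of maps from Z to the A i is a single map from Z to X:
    its values at i and j coincide, as they are those at any common bound. This
    map takes its values in every A i, hence in B. *)
Lemma closed_cocone_colimit : is_colimit closed_cocone.
Proof.
move=> c; pose Z : compHausSpace := apex c.
pose l i : @hom CompHaus Z (closedSub (@clA i)) := leg c i.
have lnat i j (ij : below i j) z : set_val (l j z) = set_val (l i z).
  exact: (congr1 (fun h : continuousType Z _ => set_val (h z))
                 (leg_natural c (ij : @hom (poset_category J) i j))).
have lE i j z : set_val (l i z) = set_val (l j z).
  have [k [ik jk]] := directed_ub i j.
  by rewrite -(lnat _ _ ik) (lnat _ _ jk).
have [i0 _] := directed_nonempty J.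
pose f : @hom CompHaus Z X := @cmp CompHaus _ _ _ (inclusion (@clA i0)) (l i0).
have fB z : B (f z).
  by rewrite BA => i _; rewrite [f z](lE i0 i); exact: set_valP.
exists (corestrict clB fB); split.
  by move=> i; apply/continuousEP => z; apply: val_inj; exact: (lE i0 i).
move=> g gl; apply: inclusion_inj; rewrite inclusion_corestrict.
apply/continuousEP => z.
exact: (congr1 (fun h : continuousType Z _ => set_val (h z)) (esym (gl i0))).
Qed.

End ClosedIntersection.

(** * Closed neighbourhoods of a point *)

Section ClosedNeighborhoods.
Variables (X : compHausSpace) (a : X).

Definition closedNbhs : directedPoset.
Proof.
refine (@DirectedPoset {A : set X | closed A /\ nbhs a A}
  (fun A B => sval B `<=` sval A) _ _ _ _ _).
- by move=> A x.
- by move=> A B C BA CB x /CB/BA.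
- move=> [A pA] [B pB] /= BA AB; apply: eq_exist; exact/seteqP.
- by exists (exist _ setT (conj closedT filterT)).
- move=> [A [cA nA]] [B [cB nB]].
  exists (exist _ (A `&` B) (conj (closedI cA cB) (filterI nA nB))).
  by split=> x [].
Defined.

(** A point b other than a has an open neighbourhood disjoint from one of a; its
    complement is a closed neighbourhood of a that misses b. *)
Lemma bigcap_closed_nbhs :
  [set a] = \bigcap_(A in [set: closedNbhs]) sval A.
Proof.
apply/seteqP; split=> [_ -> [A [cA nA]] _ /=|b ball]; first exact: nbhs_singleton.
apply: contrapT => /eqP ba; have := @space_hausdorff X.
rewrite open_hausdorff => /(_ b a ba) [[U V] /= [bU aV] [oU oV UV]].
have nC : nbhs a (~` U).
  apply: (@filterS _ _ _ V); last by apply: open_nbhs_nbhs; split=> //; exact: set_mem.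
  by move=> x Vx Ux; have : (U `&` V) x by []; rewrite (eqP UV).
have := ball (exist _ (~` U) (conj (open_closedC oU) nC)) I.
by apply; exact: set_mem.
Qed.

End ClosedNeighborhoods.

(** * Functors preserving directed colimits on connected spaces *)

Definition constant (X : compHausSpace) (a : X) : @hom CompHaus X X :=
  cmap (@cst_continuous X X a).

Section DirectedColimitPreserving.
Variable U : functor (opposite CompHaus) Sets.
Hypothesis Ucolim : preserves_directed_colimits U.

Definition pull (X Y : compHausSpace) (f : @hom CompHaus X Y) : U Y -> U X :=
  @fmap _ _ U (Y : opposite CompHaus) X f.

Lemma pull_comp (X Y Z : compHausSpace) (g : @hom CompHaus Y Z)
    (f : @hom CompHaus X Y) (x : U Z) :
  pull (@cmp CompHaus _ _ _ g f) x = pull f (pull g x).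
Proof.
exact: (congr1 (fun h => h x) (@fmap_cmp _ _ U (Z : opposite CompHaus) Y X f g)).
Qed.

(** Elements that agree at a point have the same germ there: the set of values
    at the point a is the directed colimit of the sets of values on the closed
    neighbourhoods of a. *)
Lemma pull_agree_nbhs (X : compHausSpace) (a : X) (cla : closed [set a])
    (x y : U X) :
  pull (inclusion cla) x = pull (inclusion cla) y ->
  exists (B : set X) (clB : closed B), nbhs a B /\
    pull (inclusion clB) x = pull (inclusion clB) y.
Proof.
move=> xy.
pose J := closedNbhs a.
pose A (i : J) : set X := sval i.
have clA (i : J) : closed (A i) := (svalP i).1.
have antiA (i j : J) : below i j -> A j `<=` A i by [].
have colim := Ucolim
  (@closed_cocone_colimit X J A clA antiA _ cla (bigcap_closed_nbhs a)).
have nT : nbhs a setT by exact: filterT.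
pose top : J := exist _ setT (conj closedT nT).
have restr (i : J) (B : set X) (clB : closed B) (BA : B `<=` A i) (z : U X) :
    pull (subset_incl clB (clA i) BA) (pull (inclusion (clA i)) z) =
    pull (inclusion clB) z.
  by rewrite -pull_comp inclusion_corestrict.
(* The subspace on all of X is only a copy of X, so x and y are first moved to
   it. *)
pose p z : U (closedSub (clA top)) := pull (inclusion (clA top)) z.
have [|k [tk e]] := @colimit_leg_eq _ _ _ colim top (p x) (p y).
   by rewrite [LHS]restr [RHS]restr.
exists (A k), (clA k); split; first exact: (svalP k).2.
by rewrite -(restr top _ _ (antiA _ _ tk) x) -(restr top _ _ (antiA _ _ tk) y).
Qed.

(** The element x and its constant version (const_a)^* x agree at a, hence on a
    neighbourhood B of a. For b in B, const_b factors through B, so it does not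
    distinguish them: (const_b)^* x = (const_b)^* (const_a)^* x = (const_a)^* x,
    the last step because const_a o const_b = const_a. *)
Lemma pull_constant (X : compHausSpace) (x : U X) (a b : X) :
  connected [set: X] -> pull (constant a) x = pull (constant b) x.
Proof.
move=> conX.
apply: (connected_locally_constant
  (c := fun a => pull (constant a) x)) => //.
move=> {b} {}a.
have cla : closed [set a].
  by apply: (compact_closed (@space_hausdorff X)); exact: compact_set1.
have [|B [clB [nB xB]]] := @pull_agree_nbhs X a cla x (pull (constant a) x).
  rewrite -pull_comp; congr (pull _ x).
  by apply/continuousEP => y; exact: (set_valP (y : [set a])).
apply: filterS nB => b Bb.
have bE : constant b = @cmp CompHaus _ _ _ (inclusion clB)
    (@corestrict X B clB X (constant b) (fun=> Bb)).
  by rewrite inclusion_corestrict.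
rewrite {1}bE pull_comp xB -pull_comp -bE -pull_comp.
by congr (pull _ x); apply/continuousEP.
Qed.

End DirectedColimitPreserving.

Lemma segment_comphaus : exists (X : compHausSpace) (a b : X),
  connected [set: X] /\ a <> b.
Proof.
pose R : realType := Rdefinitions.R.
pose I01 : set R := `[0%R, 1%R].
have I0 : I01 0%R by rewrite /I01 /= in_itv /= lexx ler01.
have I1 : I01 1%R by rewrite /I01 /= in_itv /= lexx ler01.
exists (compactSub (@Rhausdorff R) (@segment_compact R 0%R 1%R)).
exists (SigSub (mem_set I0)), (SigSub (mem_set I1)).
split; first exact: set_type_connected (@segment_connected R 0%R 1%R).
by move=> /(congr1 val) /= /eqP; rewrite eq_sym oner_eq0.
Qed.

Theorem corollary3p2 : ~ finitely_concrete (opposite CompHaus).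
Proof.
move=> [U [faithU colimU]].
have [X [a [b [conX]]]] := segment_comphaus; apply.
have /(faithU (X : opposite CompHaus) X) ab :
    @pull U X X (constant a) = pull (constant b).
  by apply/funext => x; exact: pull_constant.
exact: (congr1 (fun h : continuousType X X => h a) ab).
Qed.
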